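(* Let $M$ be a smooth manifold of dimension $n \geq 2$ with coordinates $(x^i)_{i=1,\dots,n}$, let $(x^i,y^i)_{i=1,\dots,n}$ be the induced coordinates on the tangent bundle $TM$, and let $X=(X^i(x))_{i=1,\dots,n}$ be a smooth vector field on $M$, producing the dynamical system $$\frac{dx^i}{dt}=X^i(x(t)),\qquad i=1,\dots,n.$$ Let $\mathcal{E}=\left(\frac{\delta \mathcal{E}^i}{\delta x^j}\right)_{i,j=1,\dots,n}$ be the $n\times n$ matrix of functions on $TM$ associated with $X$ as defined in the context. If $n$ is odd and the matrix $\mathcal{E}$ is skew-symmetric (at every point $(x,y)$ of $TM$), then the dynamical system is Jacobi unstable; that is, it is not the case that all eigenvalues of the deviation curvature tensor matrix $P(x,y)=(P^i_j(x,y))_{i,j=1,\dots,n}$ have strictly negative real part at every $(x,y)\in TM$.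
   Context: All objects are expressed in the fixed coordinates $(x^i)$ on $M$ and the induced coordinates $(x^i,y^i)$ on $TM$. Repeated indices are summed from $1$ to $n$ (regardless of index position, since the metric used is $\delta_{ij}$). In matrices with entries $A^i_j$, $i$ is the row index and $j$ the column index; the entry of $\mathcal{E}$ in row $i$, column $j$ is $\delta\mathcal{E}^i/\delta x^j$. The least squares Lagrangian of the system is $L:TM\to\mathbb{R}$, $$L(x,y)=\delta_{ij}\,(y^i-X^i(x))(y^j-X^j(x)).$$ Its Euler-Lagrange equations are $\frac{d^2x^i}{dt^2}+2G^i(x,y)=0$ with $y^i=dx^i/dt$, where the semispray is $$G^i(x,y)=\frac14\left(\frac{\partial^2 L}{\partial x^j\partial y^i}y^j-\frac{\partial L}{\partial x^i}\right)=-\frac12\left[\left(\frac{\partial X^i}{\partial x^j}-\frac{\partial X^j}{\partial x^i}\right)y^j+\frac{\partial X^j}{\partial x^i}X^j\right].$$ The Lagrangian nonlinear connection is $$N^i_j=\frac{\partial G^i}{\partial y^j}=-\frac12\left(\frac{\partial X^i}{\partial x^j}-\frac{\partial X^j}{\partial x^i}\right),$$ and the associated derivations are $$\frac{\delta}{\delta x^k}=\frac{\partial}{\partial x^k}-N^r_k\frac{\partial}{\partial y^r}.$$ The first invariant of the semispray is $$\mathcal{E}^i=2G^i-N^i_jy^j=-\frac12\left(\frac{\partial X^i}{\partial x^j}-\frac{\partial X^j}{\partial x^i}\right)y^j-\frac{\partial X^j}{\partial x^i}X^j,$$ and the matrix $\mathcal{E}=(\delta\mathcal{E}^i/\delta x^j)_{i,j}$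 has entries $$\frac{\delta\mathcal{E}^i}{\delta x^j}=-\frac12\left(\frac{\partial^2X^i}{\partial x^j\partial x^k}-\frac{\partial^2X^k}{\partial x^i\partial x^j}\right)y^k-\frac{\partial^2X^k}{\partial x^i\partial x^j}X^k-\frac{\partial X^k}{\partial x^i}\frac{\partial X^k}{\partial x^j}-\frac14\left(\frac{\partial X^k}{\partial x^j}-\frac{\partial X^j}{\partial x^k}\right)\left(\frac{\partial X^i}{\partial x^k}-\frac{\partial X^k}{\partial x^i}\right).$$ The deviation curvature tensor is the matrix $P=(P^i_j)_{i,j}$ of functions on $TM$ given by $$P^i_j=-2\frac{\partial G^i}{\partial x^j}-2G^l\frac{\partial N^i_j}{\partial y^l}+\frac{\partial N^i_j}{\partial x^l}y^l+N^i_lN^l_j.$$ Jacobi stability: the dynamical system (equivalently, the solutions of the Euler-Lagrange equations of $L$) is called Jacobi stable if and only if the real parts of all eigenvalues of $P$ are strictly negative everywhere (at every $(x,y)\in TM$), and Jacobi unstable otherwise. *)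

(* Defs.v *)
From mathcomp Require Import all_boot all_order all_algebra.
From mathcomp Require Import all_classical all_reals all_analysis.
From mathcomp Require Export complex.

Set Implicit Arguments.
Unset Strict Implicit.
Unset Printing Implicit Defensive.

Import Order.TTheory GRing.Theory Num.Theory.
Import numFieldNormedType.Exports.

Local Open Scope classical_set_scope.
Local Open Scope ring_scope.

(* The construction below is not invariant under changes of coordinates: the
   metric delta_ij, the Lagrangian and the semispray all refer to one fixed
   coordinate system on M.  A manifold with such coordinates is a space M with
   a homeomorphism x onto an open subset of R^n; its smooth structure is the one
   transported along x.  TM is M * R^n through the induced coordinates, so a
   vector field is given by its components X : M -> R^n. *)

Section Coordinates.
Context {R : realType} {n : nat}.

Definition coordinate_system (M : topologicalType) (x : M -> 'rV[R]_n) :=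
  [/\ injective x, continuous x & forall A : set M, open A -> open (x @` A)].

(* The expression u |-> f (x^-1 u) of f in the coordinates x; its value 0
   outside the open set range x is never used. *)
Definition in_coordinates (M : Type) (x : M -> 'rV[R]_n) (f : M -> 'rV[R]_n)
    (u : 'rV[R]_n) : 'rV[R]_n :=
  xget 0 (f @` (x @^-1` [set u])).

Definition partial (i : 'I_n) (f : 'rV[R]_n -> R) : 'rV[R]_n -> R :=
  fun u => 'D_(delta_mx 0 i) f u.

Definition iter_partial (s : seq 'I_n) (f : 'rV[R]_n -> R) : 'rV[R]_n -> R :=
  foldr partial f s.

(* C^oo on U (meant for U open): the partial derivatives of all orders exist
   and are continuous on U. *)
Definition smooth_on (U : set 'rV[R]_n) (f : 'rV[R]_n -> R) :=
  forall (s : seq 'I_n) (u : 'rV[R]_n), U u ->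
    {for u, continuous (iter_partial s f)} /\
    forall i, derivable (iter_partial s f) u (delta_mx 0 i).

Definition smooth_vector_field (M : Type) (x X : M -> 'rV[R]_n) :=
  forall i, smooth_on (range x) (fun u => in_coordinates x X u 0 i).

End Coordinates.

Section KCC.
Context {R : realType} {n : nat}.

(* Functions on TM in the induced coordinates (x^i, y^i), curried. *)
Local Notation tfun := ('rV[R]_n -> 'rV[R]_n -> R).

Definition dx (k : 'I_n) (F : tfun) : tfun :=
  fun u y => partial k (F ^~ y) u.

Definition dy (k : 'I_n) (F : tfun) : tfun :=
  fun u y => partial k (F u) y.

Definition least_squares_lagrangian (X : 'rV[R]_n -> 'rV[R]_n) : tfun :=
  fun u y => \sum_i (y 0 i - X u 0 i) ^+ 2.

Definition semispray (L : tfun) (i : 'I_n) : tfun :=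
  fun u y => 4%:R^-1 * (\sum_j dx j (dy i L) u y * y 0 j - dx i L u y).

(* N^i_j, with upper index i and lower index j. *)
Definition nonlinear_connection (G : 'I_n -> tfun) (i j : 'I_n) : tfun :=
  dy j (G i).

Definition delta_dx (N : 'I_n -> 'I_n -> tfun) (k : 'I_n) (F : tfun) : tfun :=
  fun u y => dx k F u y - \sum_r N r k u y * dy r F u y.

Definition first_invariant (G : 'I_n -> tfun) (i : 'I_n) : tfun :=
  fun u y =>
    2%:R * G i u y - \sum_j nonlinear_connection G i j u y * y 0 j.

Definition first_invariant_matrix (G : 'I_n -> tfun) (u y : 'rV[R]_n) :
    'M[R]_n :=
  \matrix_(i, j) delta_dx (nonlinear_connection G) j (first_invariant G i) u y.

Definition deviation_curvature (G : 'I_n -> tfun) (u y : 'rV[R]_n) : 'M[R]_n :=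
  let N := nonlinear_connection G in
  \matrix_(i, j)
    (- (2%:R * dx j (G i) u y)
     - \sum_l 2%:R * G l u y * dy l (N i j) u y
     + \sum_l dx l (N i j) u y * y 0 l
     + \sum_l N i l u y * N l j u y).

End KCC.

Section DynamicalSystem.
Context {R : realType} {n : nat} {M : Type}.
Variables (x X : M -> 'rV[R]_n).

Definition system_semispray : 'I_n -> 'rV[R]_n -> 'rV[R]_n -> R :=
  semispray (least_squares_lagrangian (in_coordinates x X)).

Definition system_E (p : M) (y : 'rV[R]_n) : 'M[R]_n :=
  first_invariant_matrix system_semispray (x p) y.

Definition system_P (p : M) (y : 'rV[R]_n) : 'M[R]_n :=
  deviation_curvature system_semispray (x p) y.

Definition jacobi_stable : Prop :=
  forall (p : M) (y : 'rV[R]_n) (z : R[i]),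
    eigenvalue (map_mx (real_complex R) (system_P p y)) z -> complex.Re z < 0.

Definition jacobi_unstable : Prop := ~ jacobi_stable.

End DynamicalSystem.

Definition skew_symmetric {R : pzRingType} {n : nat} (A : 'M[R]_n) : Prop :=
  A^T = - A.

(* Main.v *)
Require Import Defs.
From mathcomp Require Import all_boot all_order all_algebra.
From mathcomp Require Import all_classical all_reals all_analysis.
From mathcomp Require Import ring.

Set Implicit Arguments.
Unset Strict Implicit.
Unset Printing Implicit Defensive.

Import Order.TTheory GRing.Theory Num.Theory.
Import numFieldNormedType.Exports.

Local Open Scope classical_set_scope.
Local Open Scope ring_scope.

(** The zero section of TM suffices.  Write h = |X|^2 / 2.  The least squares
    Lagrangian is quadratic in y with constant leading part, so its semispray is
    affine in y,
      2 G^i = 2 N^i_j y^j - dh/dx^i,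
    with a connection N = - (DX - DX^T) / 2 that depends on x only.  Hence
      E =   (dN^i_k/dx^j) y^k - Hess h - N^2,
      P = - 2 (dN^i_k/dx^j) y^k + Hess h + (dN^i_j/dx^k) y^k + N^2,
    and at y = 0 the terms carrying derivatives of N vanish, which leaves
    P(x, 0) = - E(x, 0) ([deviation_curvature0], proved for any semispray that
    is affine in y on the fiber at hand; [semispray_affine] supplies this for
    the least squares Lagrangian).

    A skew-symmetric matrix of odd size is singular, because
    det E = det E^T = det (- E) = - det E ([det_skew_symmetric_odd]).  So
    P(x, 0) has the eigenvalue 0 at each point x, and the real part of 0 is not
    negative. *)

Section Partial.
Context {R : realType} {n : nat}.
Implicit Types (f : 'rV[R]_n -> R) (u y : 'rV[R]_n).

(** At a point where f has no partial derivative, c f has none either when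
    c != 0, and both sides are 0 by the convention on divergent limits.  This
    generality lets 2 G^i be differentiated along x for an arbitrary function
    G^i. *)
Lemma partialZ (c : R) f (k : 'I_n) u :
  partial k (fun v => c * f v) u = c * partial k f u.
Proof.
rewrite /partial; have [->|c0] := eqVneq c 0.
  by under eq_fun do rewrite mul0r; rewrite derive_cst mul0r.
have [fd|fnd] := pselect (derivable f u (delta_mx 0 k)).
  by rewrite -[LHS]/('D_(delta_mx 0 k) (c \*: f) u) deriveZ.
have cfnd : ~ derivable (fun v => c * f v) u (delta_mx 0 k).
  move=> cfd; apply: fnd.
  have -> : f = c^-1 \*: (fun v => c * f v).
    by apply/funext => v; rewrite /= [RHS]mulrA mulVf ?mul1r.
  exact: derivableZ.
have derive0 (g : 'rV[R]_n -> R) :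
    ~ derivable g u (delta_mx 0 k) -> 'D_(delta_mx 0 k) g u = 0.
  by move=> /dvgP.
by rewrite !derive0 ?mulr0.
Qed.

Lemma is_derive_coord (k i : 'I_n) y :
  is_derive y (delta_mx 0 k) (fun z : 'rV[R]_n => z 0 i) (k == i)%:R.
Proof.
have quot (h : R) : h != 0 ->
    h^-1 * ((h *: delta_mx 0 k + y) 0 i - y 0 i) = (k == i)%:R.
  by move=> h0; rewrite !mxE addrK mulKf // eqxx eq_sym.
have cvgq : (fun h : R => h^-1 *: ((h *: delta_mx 0 k + y) 0 i - y 0 i))
    @ 0^' --> ((k == i)%:R : R).
  apply: cvg_near_cst; near=> h; apply: quot.
  by near: h; exact: nbhs_dnbhs_neq.
apply: DeriveDef; first by apply: cvgP cvgq.
exact: cvg_lim cvgq.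
Unshelve. all: by end_near. Qed.

Lemma partial_affine (b : R) (a : 'I_n -> R) (k : 'I_n) y :
  partial k (fun z : 'rV[R]_n => b + \sum_j a j * z 0 j) y = a k.
Proof.
have coord j := is_derive_coord k j y.
have -> : (fun z : 'rV[R]_n => b + \sum_j a j * z 0 j) =
    cst b + \sum_j (a j \*: fun z : 'rV[R]_n => z 0 j).
  by apply/funext => z; rewrite /= fctE fct_sumE.
rewrite /partial derive_val add0r (bigD1 k) //= eqxx big1 ?addr0 ?[LHS]mulr1 //.
by move=> j /negPf jk; rewrite eq_sym jk scaler0.
Qed.

End Partial.

Section Semisprays.
Context {R : realType} {n : nat}.
Implicit Types (u y : 'rV[R]_n).

Definition fiberwise_affine (G : 'I_n -> 'rV[R]_n -> 'rV[R]_n -> R) u :=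
  exists (b : 'I_n -> R) (a : 'I_n -> 'I_n -> R),
    forall i y, G i u y = b i + \sum_j a i j * y 0 j.

(** Affineness is required on the single fiber at u, although both sides contain
    x-derivatives at u.  Those falling on N^i_j come multiplied by a component
    of y, and E^i = 2 G^i along the whole zero section, so at y = 0 the only
    x-derivative left in both E and P is that of 2 G^i.  The quadratic terms
    in N are opposite because dE^i/dy^r = 2 N^i_r - N^i_r = N^i_r. *)
Lemma deviation_curvature0 G u : fiberwise_affine G u ->
  deviation_curvature G u 0 = - first_invariant_matrix G u 0.
Proof.
move=> [b [a Gu]].
have N_E i j y : nonlinear_connection G i j u y = a i j.
  rewrite /nonlinear_connection /dy
    (_ : G i u = fun z : 'rV[R]_n => b i + \sum_j a i j * z 0 j).
    exact: partial_affine.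
  exact/funext/Gu.
apply/matrixP => i j; rewrite !mxE /delta_dx.
have -> : dx j (first_invariant G i) u 0 = 2%:R * dx j (G i) u 0.
  rewrite /dx -partialZ; congr (partial _ _ _); apply/funext => v.
  by rewrite /first_invariant big1 ?subr0 // => k _; rewrite mxE mulr0.
have dyE r : dy r (first_invariant G i) u 0 = a i r.
  rewrite /dy (_ : first_invariant G i u =
    fun z : 'rV[R]_n => 2%:R * b i + \sum_j a i j * z 0 j) ?partial_affine //.
  apply/funext => z; rewrite /first_invariant Gu.
  under [X in _ - X]eq_bigr do rewrite N_E.
  by ring.
have dyN l : dy l (nonlinear_connection G i j) u 0 = 0.
  rewrite /dy (_ : nonlinear_connection G i j u = cst (a i j)) /partial ?derive_cst //.
  by apply/funext => z; rewrite N_E.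
rewrite [X in _ - X + _ + _]big1 => [|l _]; last by rewrite dyN mulr0.
rewrite [X in _ - 0 + X + _]big1 => [|l _]; last by rewrite mxE mulr0.
rewrite subr0 addr0 opprB addrC; congr (_ - _).
by apply: eq_bigr => l _; rewrite !N_E dyE mulrC.
Qed.

(** The mixed derivative of the Lagrangian is
    d^2 L / dx^j dy^i = - 2 dX^i/dx^j, free of y, and dL/dx^i is affine in y;
    collecting the coefficients of y^j gives the curl
    dX^i/dx^j - dX^j/dx^i up to the factor - 1/2.  In the proof, d j i stands
    for dX^i/dx^j at u. *)
Lemma semispray_affine (X : 'rV[R]_n -> 'rV[R]_n) u :
  (forall i j, derivable (fun v => X v 0 i) u (delta_mx 0 j)) ->
  fiberwise_affine (semispray (least_squares_lagrangian X)) u.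
Proof.
move=> Xd; pose d j i := partial j (fun v => X v 0 i) u.
have Xder i j : is_derive u (delta_mx 0 j) (fun v => X v 0 i) (d j i).
  exact/derivableP.
have dyL i v y : dy i (least_squares_lagrangian X) v y = 2%:R * (y 0 i - X v 0 i).
  have coord j := is_derive_coord i j y.
  rewrite /dy /partial (_ : least_squares_lagrangian X v =
    \sum_j ((fun z : 'rV[R]_n => z 0 j) - cst (X v 0 j)) ^+ 2); last first.
    by apply/funext => z; rewrite fct_sumE.
  rewrite derive_val (bigD1 i) //= eqxx big1 ?addr0 => [|j /negPf ji].
    by rewrite subr0 [LHS]mulr1 expr1.
  by rewrite eq_sym ji subr0 scaler0.
have dxdyL i j y : dx j (dy i (least_squares_lagrangian X)) u y = - 2%:R * d j i.
  rewrite /dx; under eq_fun do rewrite dyL.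
  rewrite partialZ /partial (_ : (fun v => _) = cst (y 0 i) - (fun v => X v 0 i)) //.
  by rewrite derive_val sub0r mulrN mulNr.
have dxL i y : dx i (least_squares_lagrangian X) u y =
    - 2%:R * \sum_j (y 0 j - X u 0 j) * d i j.
  rewrite /dx /partial (_ : (least_squares_lagrangian X)^~ y =
    \sum_j (cst (y 0 j) - (fun v => X v 0 j)) ^+ 2); last first.
    by apply/funext => v; rewrite fct_sumE.
  rewrite derive_val mulr_sumr; apply: eq_bigr => j _ /=.
  by rewrite expr1 sub0r [LHS]mulrN mulNr mulrA.
exists (fun i => - 2%:R^-1 * \sum_j d i j * X u 0 j),
       (fun i j => - 2%:R^-1 * (d j i - d i j)) => i y.
rewrite /semispray dxL.
under eq_bigr do rewrite dxdyL.
rewrite !mulr_sumr -sumrB mulr_sumr -big_split /=.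
by apply: eq_bigr => j _; field.
Qed.

End Semisprays.

Lemma det_skew_symmetric_odd (F : numDomainType) n (A : 'M[F]_n) :
  odd n -> skew_symmetric A -> \det A = 0.
Proof.
move=> n_odd skewA; apply/eqP; rewrite -eqNr; apply/eqP.
by rewrite -[RHS]det_tr skewA -scaleN1r detZ -signr_odd n_odd mulN1r.
Qed.

Theorem theorem1 (R : realType) (n : nat) (M : topologicalType)
    (x X : M -> 'rV[R]_n) :
  (2 <= n)%N ->
  [set: M] !=set0 ->
  coordinate_system x ->
  smooth_vector_field x X ->
  odd n ->
  (forall (p : M) (y : 'rV[R]_n), skew_symmetric (system_E x X p y)) ->
  jacobi_unstable x X.
Proof.
move=> _ [p _] _ smoothX n_odd skewE stable.
have detE : \det (system_E x X p 0) = 0 by apply: det_skew_symmetric_odd.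
have P_E : system_P x X p 0 = - system_E x X p 0.
  apply/deviation_curvature0/semispray_affine => i j.
  have xp : range x (x p) by exists p.
  by have [_] := smoothX i [::] _ xp; apply.
have detP : \det (map_mx (real_complex R) (system_P x X p 0)) = 0.
  by rewrite det_map_mx P_E -scaleN1r detZ detE mulr0 rmorph0.
suff /stable : eigenvalue (map_mx (real_complex R) (system_P x X p 0)) 0.
  by rewrite ltxx.
have /eqP/det0P[v v0 vP] := detP.
by apply/eigenvalueP; exists v; rewrite // vP scale0r.
Qed.
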